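(* Let $S \subset \mathbb{A}^2(\mathbb{Q})$ be an acceptable set, and let $\mathcal{B} \subset \mathbb{C}$ be a finite set. Then there exist an integer $d \ge 4$ and a separable polynomial $f_{S,\mathcal{B}}(X) \in \mathbb{Q}[X]$ of degree $d$ with $f_{S,\mathcal{B}}(\beta) \neq 0$ for all $\beta \in \mathcal{B}$, with the following property. Let $C \subset \mathbb{P}^2$ be the superelliptic curve associated to the affine model $y^d = f_{S,\mathcal{B}}(x)$. Then $C(\mathbb{Q}) = S$; that is, the rational points of $C$ are exactly the points of $S$, viewed in $\mathbb{P}^2$ via the standard affine chart, and $C$ has no rational points at infinity.
   Context: A finite set $S = \{(a_1,b_1),\dots,(a_r,b_r)\} \subset \mathbb{A}^2(\mathbb{Q})$ of distinct rational points is called acceptable if (i) $a_i = a_j$ implies $b_i = b_j$ (so the $a_i$ are pairwise distinct), (ii) $a_i \neq 0$ and $b_j \neq 0$ for all $i,j$, and (iii) $a_i, b_j \in \mathbb{Z}$ for all $i,j$. For a separable polynomial $f \in \mathbb{Q}[x]$ of degree $d \ge 3$ and an integer $m \ge 2$, the superelliptic curve associated to the affine model $y^m = f(x)$ is the smooth projective curve in $\mathbb{P}^2$ associated to this affine model. When $m = d$, this is the projective closure in $\mathbb{P}^2$ of the affine curve $y^d = f(x)$. *)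

(* Defs.v *)
From HB Require Import structures.
From mathcomp Require Import all_boot all_order all_algebra.
From mathcomp Require Import finmap boolp classical_sets reals.
From mathcomp Require Import separable complex mpoly.

Set Implicit Arguments.
Unset Strict Implicit.
Unset Printing Implicit Defensive.

Import Order.TTheory GRing.Theory Num.Theory.

Local Open Scope ring_scope.
Local Open Scope classical_set_scope.

(* Num.int is the subring of integers of rat. *)
Definition acceptable (S : {fset rat * rat}) : Prop :=
  [/\ {in S &, forall s t, s.1 = t.1 -> s.2 = t.2},
      {in S, forall s, s.1 != 0 /\ s.2 != 0}
    & {in S, forall s, s.1 \is a Num.int /\ s.2 \is a Num.int}].

(* P^n(K) as the set of lines through the origin of K^(n+1). *)
Definition proj_space (K : fieldType) (n : nat) : Type :=
  {L : {vspace 'rV[K]_n.+1} | \dim L == 1%N}.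

Lemma affine_vec_neq0 (K : fieldType) (a b : K) :
  \row_(i < 3) tnth [tuple a; b; 1] i != 0.
Proof.
apply/eqP => /rowP /(_ ord_max); rewrite !mxE (tnth_nth 0) /=.
by apply/eqP; rewrite oner_eq0.
Qed.

Lemma dim_affine_line (K : fieldType) (s : K * K) :
  \dim <[ \row_(i < 3) tnth [tuple s.1; s.2; 1] i ]> == 1%N.
Proof. by rewrite dim_vline affine_vec_neq0. Qed.

(* The standard affine chart A^2(K) -> P^2(K), (a, b) |-> [a : b : 1]; the line
   at infinity is the vanishing locus of the last coordinate. *)
Definition std_chart (K : fieldType) (s : K * K) : proj_space K 2 :=
  Sub <[ \row_(i < 3) tnth [tuple s.1; s.2; 1] i ]>%VS (dim_affine_line s).

(* Exponent vector of the monomial 'X_[m], homogenized to total degree d by a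
   power of an extra last variable. *)
Definition homog_mnm (n d : nat) (m : 'X_{1..n}) : 'X_{1..n.+1} :=
  [multinom (if unlift ord_max i is Some j then m j else (d - mdeg m)%N)
     | i < n.+1].

(* [msize p] is 1 + the total degree of p. *)
Definition homogenize (K : fieldType) (n : nat) (p : {mpoly K[n]}) :
    {mpoly K[n.+1]} :=
  \sum_(m <- msupp p) p@_m *: 'X_[homog_mnm (msize p).-1 m].

(* K-points of the hypersurface F = 0 of P^n, for a form F: the lines on which
   F vanishes identically. *)
Definition proj_points (K : fieldType) (n : nat) (F : {mpoly K[n.+1]}) :
    set (proj_space K n) :=
  [set L : proj_space K n | forall v : 'rV[K]_n.+1, v \in val L -> F.@[fun i => v 0 i] = 0].

(* y^m - f(x) in K[x, y], with x = 'X_0 and y = 'X_1. *)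
Definition superelliptic_affine (K : fieldType) (m : nat) (f : {poly K}) :
    {mpoly K[2]} :=
  'X_(1 : 'I_2) ^+ m - (map_poly (@mpolyC 2 K) f).['X_(0 : 'I_2)].

(* The plane projective closure of y^d = f(x), i.e. the hypersurface cut out by
   the homogenized equation; for f separable of degree d >= 3 this is the smooth
   projective curve associated to y^d = f(x). *)
Definition superelliptic_curve (K : fieldType) (d : nat) (f : {poly K}) :
    {mpoly K[3]} :=
  homogenize (superelliptic_affine d f).

(* Main.v *)
(**
  The curve is built to map to [Y^2 = X^3 - 1], whose only affine rational point
  is [(1, 0)].  If [t] and [A] have no rational root, then a rational point
  [(x, y)] of
    [y^(3e) = t(x) A(x)^2 + t(x)^3 B(x)^6]
  with [B(x) <> 0] would give [X = y^e / (t B^2)] and [Y = A / (t B^3)] with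
  [Y^2 = X^3 - 1] and [Y <> 0].  So only the roots of [B] contribute, and [B] is a
  constant multiple of [prod (x - a_i)].  Interpolation makes [t A^2 = b_i^(3e)] at [a_i].
  Choosing [deg A = deg t + 3 deg B] lets the same argument, applied to the
  leading coefficients, exclude points at infinity.  The polynomials [t] and [A]
  have the form [G + H / p] with [p] a large prime and [H] a product of linear
  factors, each repeated: this excludes rational roots [p]-adically, while for all
  but finitely many [p] the member [G + H / p] of the pencil is separable and
  avoids a given finite set.
*)
Require Import Defs.
From mathcomp Require Import all_boot all_order all_algebra.
From mathcomp Require Import finmap boolp classical_sets reals.
From mathcomp Require Import separable complex mpoly.
From mathcomp Require Import zify ring.

Import Order.TTheory GRing.Theory Num.Theory.

Local Open Scope ring_scope.
Local Open Scope classical_set_scope.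

(** * A descent on Y^2 = X^3 - 1 *)

(** Put [a = gcdn m s] and [b = gcdn n s]. By coprimality [a ^ k] divides [m], [b ^ k] divides [n],
    and [s = a * b]; comparing products forces equality. If one factor is 0, coprimality makes the
    other 1. *)
Lemma coprime_mul_exp (m n s k : nat) : (0 < k)%N -> coprime m n ->
  (m * n = s ^ k)%N ->
  exists a b, [/\ m = (a ^ k)%N, n = (b ^ k)%N & s = (a * b)%N].
Proof.
move=> k_gt0 cmn mnE; pose a := gcdn m s; pose b := gcdn n s.
have cab : coprime a b.
  exact: coprime_dvdl (dvdn_gcdl _ _) (coprime_dvdr (dvdn_gcdl _ _) cmn).
have dm : (a ^ k %| m)%N.
  rewrite -(@Gauss_dvdl _ _ n).
    by rewrite mnE dvdn_exp2r // dvdn_gcdr.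
  by rewrite coprimeXl // (coprime_dvdl (dvdn_gcdl _ _)).
have dn : (b ^ k %| n)%N.
  rewrite -(@Gauss_dvdr _ m n).
    by rewrite mnE dvdn_exp2r // dvdn_gcdr.
  by rewrite coprimeXl // coprime_sym (coprime_dvdr (dvdn_gcdl _ _)).
have sE : s = (a * b)%N.
  apply/eqP; rewrite eqn_dvd; apply/andP; split.
    rewrite /b muln_gcdr dvdn_gcd (dvdn_mull _ (dvdnn s)) andbT.
    rewrite /a muln_gcdl dvdn_gcd (dvdn_mulr _ (dvdnn s)) andbT.
    by rewrite mnE -(prednK k_gt0) expnS dvdn_mulr.
  by rewrite Gauss_dvd // !dvdn_gcdr.
have [m0|m_gt0] := posnP m.
  have s0 : s = 0%N.
    by move/esym/eqP: mnE; rewrite m0 mul0n expn_eq0 => /andP[/eqP].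
  have /eqP n1 : n == 1%N by move: cmn; rewrite m0 /coprime gcd0n.
  by exists 0%N, 1%N; rewrite exp1n exp0n ?mul0n.
have [n0|n_gt0] := posnP n.
  have s0 : s = 0%N.
    by move/esym/eqP: mnE; rewrite n0 muln0 expn_eq0 => /andP[/eqP].
  have /eqP m1 : m == 1%N by move: cmn; rewrite n0 /coprime gcdn0.
  by exists 1%N, 0%N; rewrite exp1n exp0n ?muln0.
exists a, b; have := mnE; rewrite {1}sE expnMn.
have := dvdn_leq m_gt0 dm; have := dvdn_leq n_gt0 dn.
move: (_ ^ k)%N => B + ; move: (_ ^ k)%N => A lB lA E; split=> //; nia.
Qed.

(** By symmetry the prime 3 may be taken to divide [v]; removing it leaves two coprime factors of
    [s ^ 4]. *)
Lemma coprime_mul_3exp4 (u v s : nat) : coprime u v -> (u * v = 3 * s ^ 4)%N ->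
  exists k l, [/\ s = (k * l)%N, coprime k l &
    (u = k ^ 4 /\ v = 3 * l ^ 4)%N \/ (u = 3 * l ^ 4 /\ v = k ^ 4)%N].
Proof.
wlog: u v / (3 %| v)%N => [wl cuv uvE|/dvdnP[w ->] cuv uvE].
  have : (3 %| u * v)%N by rewrite uvE dvdn_mulr.
  rewrite Euclid_dvdM // => /orP[d3|d3]; last exact: wl.
  have [] := wl v u d3; [by rewrite coprime_sym | by rewrite mulnC |].
  move=> k [l [sE ckl [[-> ->]|[-> ->]]]]; exists k, l; split=> //.
    by right.
  by left.
have [||k [l [uE wE sE]]] := @coprime_mul_exp u w s 4 isT.
- exact: coprime_dvdr (dvdn_mulr _ (dvdnn _)) cuv.
- by apply/eqP; rewrite -(@eqn_pmul2l 3) // -uvE; apply/eqP; ring.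
exists k, l; split=> //; last by left; rewrite uE wE mulnC.
have := cuv; rewrite coprimeMr => /andP[+ _].
by rewrite uE wE coprime_pexpl // coprime_pexpr.
Qed.

(* A common prime p of u and u + w satisfies p^2 | 3 a^4, hence p | a. *)
Lemma coprime_mul_3exp4_add (u w a : nat) :
  (u * (u + w) = 3 * a ^ 4)%N -> coprime a w -> coprime u (u + w).
Proof.
move=> uwE caw; rewrite /coprime -(negbK (_ == _)%N); apply/negP => g1.
have [p p_pr pg] : exists2 p, prime p & (p %| gcdn u (u + w))%N.
  case: (posnP (gcdn u (u + w))) => [->|g_gt0]; first by exists 2.
  exists (pdiv (gcdn u (u + w))); last exact: pdiv_dvd.
  by apply: pdiv_prime; lia.
move: pg; rewrite dvdn_gcd => /andP[pu puw].
have pw : (p %| w)%N by rewrite -(dvdn_addr _ pu).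
have : (p * p %| 3 * a ^ 4)%N by rewrite -uwE dvdn_mul.
have [pa|pa] := boolP (p %| a)%N.
  have : (p %| gcdn a w)%N by rewrite dvdn_gcd pa.
  by rewrite (eqP caw) dvdn1 => /eqP p1; rewrite p1 in p_pr.
rewrite Gauss_dvdl; last by rewrite mulnn coprimeXr // coprimeXl // prime_coprime.
move/dvdn_leq => /(_ isT); have := prime_gt1 p_pr; nia.
Qed.


(** Modulo 3 two squares, those of [r ^ 2] and [b], would sum to 0, so 3 would divide both [r] and
    [b]. *)
Lemma quartic_mod3_obstruction (b r s : nat) : coprime (r * s) b ->
  (r ^ 4 + b ^ 2 + 6 * r ^ 2 * s ^ 2 <> 3 * s ^ 4)%N.
Proof.
move=> crsb E.
have [r3 b3] : (3 %| r)%N /\ (3 %| b)%N.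
  have : (3 %| r ^ 4 + b ^ 2)%N.
    by rewrite -(@dvdn_addl (6 * r ^ 2 * s ^ 2) 3) ?E -?mulnA dvdn_mulr.
  rewrite /dvdn.
  rewrite -modnDm -(modnXm 4) -(modnXm 2).
  have := ltn_pmod r (isT : 0 < 3)%N; have := ltn_pmod b (isT : 0 < 3)%N.
  rewrite /dvdn; case: (r %% 3)%N => [|[|[|]]] //; case: (b %% 3)%N => [|[|[|]]] //.
have : (3 %| gcdn (r * s) b)%N by rewrite dvdn_gcd dvdn_mulr.
by rewrite (eqP crsb).
Qed.

(** Modulo 16 odd fourth powers are 1 and [6 * r ^ 2 * s ^ 2] is 6, so the left side is 9 or 13
    according to the parity of [b], and the right side is 1. *)
Lemma quartic_mod16_obstruction (b r s : nat) : odd (r * s) ->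
  (3 * s ^ 4 + 4 * b ^ 2 + 6 * r ^ 2 * s ^ 2 <> r ^ 4)%N.
Proof.
have sqr8 x : odd x -> exists X, (x ^ 2 = 8 * X + 1)%N.
  move=> x_odd; rewrite -(odd_double_half x) x_odd.
  have : (2 %| x./2 * (x./2).+1)%N by rewrite dvdn2 oddM /= andbN.
  by case/dvdnP=> y yE; exists y; move: yE; rewrite add1n -mul2n; move: x./2 => h yE; nia.
rewrite oddM => /andP[/sqr8[X rE] /sqr8[Y sE]].
rewrite (expnM s 2 2) (expnM r 2 2) rE sE -(odd_double_half b) -mul2n.
by case: (odd b); move: b./2 => h; lia.
Qed.

Lemma exists_half_diff (x y : nat) :
  odd x = odd y -> (y <= x)%N -> exists u, (x = 2 * u + y)%N.
Proof.
move=> oxy le_yx; exists (x - y)./2.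
rewrite mul2n -[in LHS](subnK le_yx) -[in LHS](odd_double_half (x - y)).
by rewrite oddB // oxy addbb.
Qed.

Lemma factor_sqr_add (u w n : nat) :
  ((u + w) ^ 2 = w ^ 2 + n)%N -> (u * (u + 2 * w) = n)%N.
Proof. by move=> E; apply/eqP; rewrite -(eqn_add2l (w ^ 2)) -E; apply/eqP; ring. Qed.

Lemma factor_sqr_add_double (u w n : nat) :
  ((2 * u + w) ^ 2 = w ^ 2 + 4 * n)%N -> (u * (u + w) = n)%N.
Proof.
move/factor_sqr_add => E; apply/eqP; rewrite -(@eqn_pmul2l 4) // -E.
by apply/eqP; ring.
Qed.

(** Completes the square at [m = x - 3 * y]. Cancelling the positive [x] shows [3 * y <= x], so the
    subtraction is not truncated. *)
Lemma complete_sqr_sub (x y n : nat) : (0 < x)%N ->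
  (x ^ 2 = n + 6 * x * y + 3 * y ^ 2)%N ->
  exists m, (x = m + 3 * y /\ m ^ 2 = n + 12 * y ^ 2)%N.
Proof.
move=> x_gt0 xE; have le_yx : (3 * y <= x)%N.
  by rewrite -(leq_pmul2l x_gt0) mulnn xE; lia.
exists (x - 3 * y)%N; rewrite subnK //; split=> //.
move: xE; rewrite -{1 2}(subnK le_yx); move: (_ - _)%N => m; lia.
Qed.

(* Descent along the two 2-isogenies linking the quartic to its dual
   b^2 = r^4 - 6 r^2 s^2 - 3 s^4 and back. *)
Lemma quartic_descent (a b c : nat) : coprime a b ->
  (c ^ 2 = b ^ 4 + 3 * a ^ 2 * b ^ 2 + 3 * a ^ 4)%N -> a = 0%N.
Proof.
elim/ltn_ind: a b c => a IH b c cab cE; apply/eqP; case: posnP => // a_gt0.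
have a4_gt0 : (0 < a ^ 4)%N by rewrite expn_gt0 a_gt0.
(* Completing the square in [b ^ 2] exhibits [3 * a ^ 4] as a difference of two squares, ready to be
   factored. *)
have c2E : ((2 * c) ^ 2 = (2 * b ^ 2 + 3 * a ^ 2) ^ 2 + 3 * a ^ 4)%N.
  by rewrite expnMn cE; ring.
have lt_wc : (2 * b ^ 2 + 3 * a ^ 2 < 2 * c)%N by rewrite -ltn_sqr c2E; lia.
(* For odd [a], the two ways of sharing [3 * a ^ 4] between coprime factors fail modulo 3 and modulo
   16 respectively. *)
have [a_odd|a_even] := boolP (odd a).
  pose w := (2 * (2 * b ^ 2 + 3 * a ^ 2))%N.
  have [u uE] : exists u, (2 * c = u + (2 * b ^ 2 + 3 * a ^ 2))%N.
    by exists (2 * c - (2 * b ^ 2 + 3 * a ^ 2))%N; lia.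
  have uwE : (u * (u + w) = 3 * a ^ 4)%N.
    by apply: factor_sqr_add; rewrite -uE.
  have caw : coprime a w.
    rewrite (_ : w = 6 * a * a + 2 ^ 2 * b ^ 2)%N; last by rewrite /w; ring.
    by rewrite /coprime gcdnMDl -/(coprime _ _) coprimeMr !coprimeXr ?coprimen2.
  have [r [s [aE crs E]]] :=
  coprime_mul_3exp4 _ _ _ (coprime_mul_3exp4_add _ _ _ uwE caw) uwE.
  case: E => [[uE' vE]|[uE' vE]].
    case: (@quartic_mod3_obstruction (2 * b) r s).
      by rewrite -aE coprimeMr coprimen2 a_odd.
    by rewrite -vE uE' /w aE; ring.
  case: (@quartic_mod16_obstruction b r s); first by rewrite -aE.
  by rewrite -vE uE' /w aE; ring.
have [a' aE] : exists a', (a = 2 * a')%N.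
  by exists a./2; rewrite mul2n -[LHS]odd_double_half (negPf a_even).
have b_odd : odd b.
  by move: cab; rewrite aE coprimeMl coprime2n => /andP[].
(* For even [a] a factor 4 drops out: [c] and [w] have the same parity, and half their difference
   gives factors [u] and [u + w] of [3 * a' ^ 4]. *)
pose w := (b ^ 2 + 6 * a' ^ 2)%N.
have cwE : (c ^ 2 = w ^ 2 + 12 * a' ^ 4)%N by rewrite cE aE /w; ring.
have [u uE] : exists u, (c = 2 * u + w)%N.
  apply: exists_half_diff; last by rewrite -leq_sqr cwE leq_addr.
  have : odd (c ^ 2) = odd w by rewrite cwE oddD oddM oddX addbF.
  by rewrite oddX.
have uwE : (u * (u + w) = 3 * a' ^ 4)%N
  by apply: factor_sqr_add_double; rewrite -uE cwE mulnA.
have ca'b : coprime a' b by move: cab; rewrite aE coprimeMl => /andP[].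
have caw : coprime a' w.
  rewrite (_ : w = 6 * a' * a' + b ^ 2)%N; last by rewrite /w; ring.
  by rewrite /coprime gcdnMDl -/(coprime _ _) coprimeXr.
have [r [s [a'E crs E]]] :=
  coprime_mul_3exp4 _ _ _ (coprime_mul_3exp4_add _ _ _ uwE caw) uwE.
have crsb : coprime (r * s) b by rewrite -a'E.
case: E => [[uE' vE]|[uE' vE]].
  by case: (@quartic_mod3_obstruction b r s) => //; rewrite -vE uE' /w a'E; ring.
(* The surviving case lies on the dual quartic. Completing the square in [r ^ 2] yields a second
   factorization, now of [3 * s ^ 4]. *)
have rsE : ((r ^ 2) ^ 2 = b ^ 2 + 6 * r ^ 2 * s ^ 2 + 3 * s ^ 4)%N.
  by rewrite -expnM -vE uE' /w a'E; ring.
have [r_gt0 s_gt0] : (0 < r /\ 0 < s)%N.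
  by apply/andP; rewrite -muln_gt0 -a'E -(@ltn_pmul2l 2) // -aE.
have [m [mE mbE]] : exists m, (r ^ 2 = m + 3 * s ^ 2 /\ m ^ 2 = b ^ 2 + 12 * s ^ 4)%N.
  rewrite (expnM s 2 2); apply: complete_sqr_sub; rewrite ?expn_gt0 ?r_gt0 //.
  by rewrite rsE -(expnM s).
have [v vE'] : exists v, (m = 2 * v + b)%N.
  apply: exists_half_diff; last by rewrite -leq_sqr mbE leq_addr.
  have : odd (m ^ 2) = odd b by rewrite mbE oddD oddM oddX addbF.
  by rewrite oddX.
have vbE : (v * (v + b) = 3 * s ^ 4)%N
  by apply: factor_sqr_add_double; rewrite -vE' mbE mulnA.
have csb : coprime s b.
  by move: crsb; rewrite coprimeMl => /andP[].
have [k [l [sE ckl E]]] :=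
  coprime_mul_3exp4 _ _ _ (coprime_mul_3exp4_add _ _ _ vbE csb) vbE.
(* Now [r ^ 2 = k ^ 4 + 3 * k ^ 2 * l ^ 2 + 3 * l ^ 4]: the original quartic at [(l, k, r)], smaller
   because [a = 2 * r * k * l]. *)
have l0 : l = 0%N.
  apply: (IH l _ k r); first 1 last.
  - by rewrite coprime_sym.
  - rewrite mE vE' sE (_ : 2 * v + b = v + (v + b))%N; last by ring.
    by case: E => -[E1 E2]; rewrite E2 E1; ring.
  have [k_gt0 l_gt0] : (0 < k /\ 0 < l)%N by apply/andP; rewrite -muln_gt0 -sE.
  have le_l : (l <= r * (k * l))%N by rewrite mulnA leq_pmull // muln_gt0 r_gt0.
  by rewrite aE a'E sE (leq_ltn_trans le_l) // ltn_Pmull // muln_gt0 r_gt0 -sE.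
by move: a_gt0; rewrite aE a'E sE l0 !muln0.
Qed.

(** With [w = p - a ^ 2], the difference of cubes factors as [w * (w ^ 2 + 3 * w * a ^ 2 + 3 * a ^
    4) = n ^ 2]. Up to a common factor 3 both factors are squares, and the second one becomes the
    quartic of [quartic_descent]. *)
Lemma cube_eq_sqr_add_exp6 (p a n : nat) : (0 < a)%N -> coprime p a ->
  (p ^ 3 = n ^ 2 + (a ^ 2) ^ 3)%N -> n = 0%N.
Proof.
move=> a_gt0 cpa pE.
have [w wE] : exists w, (p = w + a ^ 2)%N.
  by exists (p - a ^ 2)%N; rewrite subnK // -(@leq_exp2r _ _ 3) // pE leq_addl.
have cwa : coprime w a.
  by move: cpa; rewrite wE coprime_sym /coprime addnC -mulnn gcdnMDl gcdnC.
have nE : (w * (w ^ 2 + 3 * w * a ^ 2 + 3 * a ^ 4) = n ^ 2)%N.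
  by apply/eqP; rewrite -(eqn_add2r ((a ^ 2) ^ 3)) -pE wE; apply/eqP; ring.
(* The second factor is [3 * a ^ 4] modulo [w], so 3 is the only possible common prime. If it
   occurs, 9 cancels and the quartic appears with [a] and [b] exchanged. *)
have [/dvdnP[v vE]|w3] := boolP (3 %| w)%N.
  have /dvdnP[k kE] : (3 %| n)%N.
    have : (3 %| n ^ 2)%N by rewrite -nE vE mulnAC dvdn_mull.
    by rewrite Euclid_dvdX // andbT.
  have vkE : (v * (a ^ 4 + 3 * v * a ^ 2 + 3 * v ^ 2) = k ^ 2)%N.
    apply/eqP; rewrite -(@eqn_pmul2l 9) //; apply/eqP; move: nE; rewrite vE kE => E.
    transitivity ((k * 3) ^ 2)%N; last by ring.
    by rewrite -E; ring.
  have cva : coprime v a by move: cwa; rewrite vE coprimeMl => /andP[].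
  have [//||b [c [bE cE _]]] := @coprime_mul_exp _ _ _ 2 _ _ vkE.
    rewrite (_ : _ + _ = (3 * a ^ 2 + 3 * v) * v + a ^ 4)%N; last by ring.
    by rewrite /coprime gcdnMDl -/(coprime _ _) coprimeXr.
  have b0 : b = 0%N.
    apply: (@quartic_descent b a c); last by rewrite -cE bE; ring.
    by rewrite -(@coprime_pexpl 2) // -bE.
  by move/esym/eqP: vkE; rewrite bE b0 mul0n expn_eq0 andbT kE => /eqP->.
have [//||b [c [bE cE _]]] := @coprime_mul_exp _ _ _ 2 _ _ nE.
  rewrite (_ : _ + _ = (w + 3 * a ^ 2) * w + 3 * a ^ 4)%N; last by ring.
  rewrite /coprime gcdnMDl -/(coprime _ _) coprimeMr (coprimeXr _ cwa) andbT.
  by rewrite coprime_sym prime_coprime.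
have a0 : a = 0%N.
  apply: (@quartic_descent a b c); last by rewrite -cE bE; ring.
  by rewrite coprime_sym -(@coprime_pexpl 2) // -bE.
by rewrite a0 in a_gt0.
Qed.

(** In lowest terms the denominators of [X] and [Y] are [a ^ 2] and [a ^ 3] for one [a], which
    reduces the claim to [cube_eq_sqr_add_exp6]. *)
Lemma sqr_add1_eq_cube (X Y : rat) : Y ^+ 2 + 1 = X ^+ 3 -> Y = 0.
Proof.
move=> XYE; have X_gt0 : 0 < X.
  have : 0 < X ^+ 3 by rewrite -XYE ltr_wpDl // sqr_ge0.
  by rewrite exprn_odd_gt0.
pose p := `|numq X|%N; pose q := `|denq X|%N.
pose n := `|numq Y|%N; pose m := `|denq Y|%N.
have cpq : coprime p q := coprime_num_den X.
have cnm : coprime n m := coprime_num_den Y.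
have q_gt0 : (0 < q)%N by rewrite absz_gt0 denq_neq0.
have m_gt0 : (0 < m)%N by rewrite absz_gt0 denq_neq0.
have XE : X = p%:R / q%:R.
  rewrite -[LHS]divq_num_den !natr_absz !ger0_norm ?denq_ge0 //.
  by rewrite numq_ge0 ltW.
have YE : Y ^+ 2 = n%:R ^+ 2 / m%:R ^+ 2.
  rewrite -[in LHS](divq_num_den Y) expr_div_n -!natrX -!abszX !natr_absz.
  by rewrite !ger0_norm ?sqr_ge0 // !rmorphXn.
have E : (p ^ 3 * m ^ 2 = q ^ 3 * (n ^ 2 + m ^ 2))%N.
  apply/eqP; rewrite -(eqr_nat rat) !natrM natrD !natrX; apply/eqP.
  have q0 : q%:R != 0 :> rat by rewrite pnatr_eq0 -lt0n.
  have m0 : m%:R != 0 :> rat by rewrite pnatr_eq0 -lt0n.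
  have -> : p%:R = X * q%:R by rewrite XE divfK.
  rewrite [LHS](_ : _ = X ^+ 3 * q%:R ^+ 3 * m%:R ^+ 2); last by ring.
  by rewrite -XYE YE; field.
have qmE : (q ^ 3 = m ^ 2)%N.
  apply/eqP; rewrite eqn_dvd; apply/andP; split.
    have cqp : coprime (q ^ 3) (p ^ 3).
      by rewrite coprimeXl // coprimeXr // coprime_sym.
    by rewrite -(Gauss_dvdr _ cqp) E dvdn_mulr.
  have cmn : coprime (m ^ 2) (n ^ 2 + m ^ 2).
    by rewrite /coprime addnC gcdnDl -/(coprime _ _) coprimeXl // coprimeXr // coprime_sym.
  by rewrite -(Gauss_dvdl _ cmn) -E dvdn_mull.
have /dvdnP[a mE] : (q %| m)%N.
  by rewrite -(@dvdn_pexp2r _ _ 2) // -qmE dvdn_exp2l.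
have qE : q = (a ^ 2)%N.
  apply/eqP; rewrite -(@eqn_pmul2r (q ^ 2)) ?expn_gt0 ?q_gt0 // -expnS qmE mE.
  by rewrite expnMn.
have n0 : n = 0%N.
  apply: (@cube_eq_sqr_add_exp6 p a n).
  - by move: m_gt0; rewrite mE muln_gt0 => /andP[].
  - by move: cpq; rewrite qE coprime_pexpr.
  apply/eqP; rewrite -(@eqn_pmul2r (m ^ 2)) ?expn_gt0 ?m_gt0 // E -qE qmE.
  by rewrite mulnC.
by apply/eqP; rewrite -sqrf_eq0 YE n0 expr0n mul0r.
Qed.

(** * Polynomials without rational roots *)

Lemma Euclid_dvdzM (p : nat) (x y : int) : prime p ->
  (p %| x * y)%Z = (p %| x)%Z || (p %| y)%Z.
Proof. by move=> p_pr; rewrite !dvdzE abszM Euclid_dvdM. Qed.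

Lemma Euclid_dvdz_prod (p : nat) (T : eqType) (s : seq T) (F : T -> int) :
  prime p -> (p %| \prod_(b <- s) F b)%Z -> exists2 b, b \in s & (p %| F b)%Z.
Proof.
move=> p_pr; elim: s => [|b s IH].
  by rewrite big_nil dvdzE dvdn1 => /eqP p1; move: p_pr; rewrite [p]p1.
rewrite big_cons Euclid_dvdzM // => /orP[pb|/IH[c cs pc]].
  by exists b; rewrite ?mem_head.
by exists c; rewrite // in_cons cs orbT.
Qed.

(** [c] is the degree [h] homogenization of [g] at [(u, v)]. Modulo [u - a * v] one may replace [u]
    by [a * v]. *)
Lemma homogeneous_value (g : {poly int}) (h : nat) (u v : int) :
  (size g <= h.+1)%N ->
  exists c : int,
    (v != 0 -> c%:~R = v%:~R ^+ h * (map_poly intr g).[u%:~R / v%:~R] :> rat)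
    /\ (forall a : int, (u - a * v %| c - v ^+ h * g.[a])%Z).
Proof.
move=> size_g; exists (\sum_(i < h.+1) g`_i * u ^+ i * v ^+ (h - i)); split=> [v0|a].
  rewrite (@horner_coef_wide _ h.+1); last first.
    by rewrite (leq_trans (size_poly _ _)).
  rewrite rmorph_sum mulr_sumr; apply: eq_bigr => i _.
  rewrite !rmorphM !rmorphXn /= coef_map /= expr_div_n.
  have v0' : v%:~R != 0 :> rat by rewrite intr_eq0.
  rewrite -[X in v%:~R ^+ X * _](@subnK i h) -1?ltnS // exprD.
  by field; rewrite expf_neq0.
rewrite (@horner_coef_wide _ h.+1) // mulr_sumr -sumrB.
elim/big_ind: _ => [|x y|i _]; first exact: dvdz0.
  exact: rpredD.
have -> : g`_i * u ^+ i * v ^+ (h - i) - v ^+ h * (g`_i * a ^+ i) =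
    g`_i * v ^+ (h - i) * (u ^+ i - (a * v) ^+ i).
  rewrite -[X in v ^+ X * (_ * _)](@subnK i h) -1?ltnS // exprD exprMn.
  ring.
by rewrite subrXX dvdz_mull // dvdz_mulr.
Qed.

Lemma prod_XsubC_frac (s : seq int) (u v : int) : v != 0 ->
  (\prod_(a <- s) (u - a * v))%:~R =
    v%:~R ^+ size s * (\prod_(a <- s) ('X - (a%:~R)%:P)).[u%:~R / v%:~R] :> rat.
Proof.
move=> v0; have v0' : v%:~R != 0 :> rat by rewrite intr_eq0.
elim: s => [|a s IH]; first by rewrite !big_nil hornerC mulr1.
rewrite !big_cons rmorphM /= IH hornerM hornerXsubC exprS rmorphB rmorphM /=.
by field.
Qed.

Lemma prime_notin_dvdz (p : nat) (z : int) : z != 0 -> (`|z| < p)%N -> ~~ (p %| z)%Z.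
Proof.
by move=> z0 lt_zp; rewrite dvdzE gtnNdvd // absz_gt0.
Qed.

(** A root [u / v] in lowest terms would give [p * c + a * (m ^ 2 * m') = 0], where [c] homogenizes
    an integral multiple of [G]; the size bound lets one power of [v] clear both terms. Divisibility
    by [p] then forces [p] to divide [u] and [v]. *)
Lemma no_rational_root (G : {poly rat}) (s s' : seq int) :
  {subset s' <= s} -> (size G <= (size s * 2 + size s').+1)%N ->
  (forall a, a \in s -> G.[a%:~R] != 0) ->
  exists N, forall p, prime p -> (N < p)%N -> forall x : rat,
    (G + p%:R^-1 *: ((\prod_(a <- s) ('X - (a%:~R)%:P)) ^+ 2 *
                     \prod_(a <- s') ('X - (a%:~R)%:P))).[x] != 0.
Proof.
move=> sub_s; have [g [a a0 ->]] := rat_poly_scale G.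
have ainv0 : a%:~R^-1 != 0 :> rat by rewrite invr_eq0 intr_eq0.
rewrite size_scale // size_map_inj_poly ?rmorph0 //; last exact: intr_inj.
set h := (_ + _)%N => size_g g_neq0.
(* Beyond this bound [p] divides neither the denominator [a] nor any value [g.[b]] at a node. *)
exists (`|a| + \sum_(b <- s) `|g.[b]|)%N => p p_pr lt_p x; apply/negP => /eqP.
have p0 : p%:R != 0 :> rat by rewrite pnatr_eq0 -lt0n prime_gt0.
set u := numq x; set v := denq x.
have v0 : v != 0 := denq_neq0 x.
have xE : x = u%:~R / v%:~R by rewrite divq_num_den.
have [c [cE cdvd]] := @homogeneous_value g h u v size_g.
pose m := \prod_(b <- s) (u - b * v); pose m' := \prod_(b <- s') (u - b * v).
rewrite !(hornerD, hornerZ, hornerM, horner_exp) => /eqP E.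
have {E} E : p%:Z * c + a * (m ^+ 2 * m') = 0.
  apply/eqP; rewrite -(intr_eq0 rat) rmorphD !rmorphM /= cE //.
  rewrite !prod_XsubC_frac // -xE /h exprD exprM.
  move: E; set gx := (map_poly _ g).[x]; rewrite -/gx.
  move: (\prod_(b <- s) _).[x] (\prod_(b <- s') _).[x] => P P' E.
  rewrite [X in X == _](_ : _ = p%:R * a%:~R * v%:~R ^+ size s ^+ 2 * v%:~R ^+ size s' *
    (a%:~R^-1 * gx + p%:R^-1 * (P * P * P'))); first by rewrite (eqP E) mulr0.
  by rewrite -pmulrn; field; rewrite p0 intr_eq0.
have p_a : ~~ (p %| a)%Z by apply: prime_notin_dvdz => //; lia.
have p_g b : b \in s -> ~~ (p %| g.[b])%Z.
  move=> bs; apply: prime_notin_dvdz.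
    by have := g_neq0 _ bs; rewrite hornerZ horner_map mulf_eq0 negb_or intr_eq0 => /andP[].
  by apply: leq_ltn_trans _ lt_p; rewrite (big_rem b) //= addnCA leq_addr.
(* The linear factors in [m ^+ 2 * m'] are repeated, so one of them being
   divisible by [p] forces [p ^ 2] to divide the product, and then [p %| c]. *)
have p_mm : (p %| a * (m ^+ 2 * m'))%Z.
  by rewrite -(@rpredDl _ _ (p%:Z * c)) ?E ?dvdz0 // dvdz_mulr.
have [b bs pb] : exists2 b, b \in s & (p %| u - b * v)%Z.
  move: p_mm; rewrite Euclid_dvdzM // (negPf p_a) /= Euclid_dvdzM // expr2 Euclid_dvdzM // orbb.
  case/orP=> /(Euclid_dvdz_prod _)-/(_ p_pr)[b bs pb]; exists b => //.
  exact: sub_s.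
have pm : (p %| m)%Z by rewrite /m (big_rem b) //= dvdz_mulr.
have pc : (p %| c)%Z.
  have p0z : p%:Z != 0 by rewrite -lt0n prime_gt0.
  rewrite -(@dvdz_mul2l p) // -(@rpredDr _ _ (a * (m ^+ 2 * m'))) ?E ?dvdz0 //.
  by rewrite dvdz_mull // dvdz_mulr // expr2 dvdz_mul.
(* As [p] divides [u - b * v], [c] is congruent to [v ^+ h * g.[b]]; hence [p] divides [v], then
   [u]. *)
have : (p %| v ^+ h * g.[b])%Z.
  rewrite -(@rpredBl _ _ c) //.
  exact: dvdz_trans (cdvd b).
rewrite Euclid_dvdzM // (negPf (p_g _ bs)) orbF => pvh.
have pv : (p %| v)%Z.
  by move: pvh; rewrite !dvdzE abszX Euclid_dvdX // => /andP[].
have pu : (p %| u)%Z.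
  by rewrite -(@rpredBr _ _ (b * v)) // dvdz_mull.
have := coprime_num_den x; rewrite -/u -/v.
move: pu pv; rewrite !dvdzE /= => pu pv /eqP g1.
by have := prime_gt1 p_pr; rewrite ltnNge dvdn_leq // -g1 dvdn_gcd pu.
Qed.

(** * Pencils of polynomials *)

(** Each [z] spoils at most one [n]: two members of the pencil vanishing at [z] would make [z] a
    common root of [G] and [H]. *)
Lemma pencil_avoid (C : numFieldType) (G H : {poly C}) (Z : seq C) :
  coprimep G H ->
  exists N, forall n, (N < n)%N -> forall z, z \in Z ->
    (G + n%:R^-1 *: H).[z] != 0.
Proof.
move=> cGH; elim: Z => [|z Z [N IH]]; first by exists 0%N.
have [[n0 n0_gt0 En0]|noN] :=
  pselect (exists2 n0, (0 < n0)%N & (G + n0%:R^-1 *: H).[z] = 0).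
  exists (maxn N n0) => n; rewrite gtn_max => /andP[ltNn ltn0n] z'.
  rewrite in_cons => /predU1P[->|]; last exact: IH.
  apply/eqP => En; move: En0 En; rewrite !hornerE.
  set g := G.[z]; set h := H.[z] => En0 En.
  have n0' : n0%:R != 0 :> C by rewrite pnatr_eq0 -lt0n.
  have n' : n%:R != 0 :> C by rewrite pnatr_eq0 -lt0n (leq_ltn_trans _ ltn0n).
  have dn : n%:R - n0%:R != 0 :> C by rewrite subr_eq0 eqr_nat; lia.
  have h0 : h = 0.
    have : (n%:R - n0%:R) * h = n%:R * n0%:R * ((g + n0%:R^-1 * h) - (g + n%:R^-1 * h)).
      by field; rewrite n' n0'.
    by rewrite En0 En subrr mulr0 => /eqP; rewrite mulf_eq0 (negPf dn) => /eqP.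
  have g0 : root G z by apply/eqP; move: En0; rewrite h0 mulr0 addr0.
  by have := coprimep_root cGH g0; rewrite -/h h0 eqxx.
exists N => n ltNn z'; rewrite in_cons => /predU1P[->|]; last exact: IH.
by apply/eqP => En; apply: noN; exists n => //; apply: leq_ltn_trans ltNn.
Qed.

Lemma wronskian_neq0 (F : numFieldType) (G H : {poly F}) :
  coprimep G H -> (1 < size H)%N -> G * H^`() - G^`() * H != 0.
Proof.
move=> cGH size_H; rewrite subr_eq0; apply/eqP => E.
have cHG : coprimep H G by rewrite coprimep_sym.
have : H %| H^`() by rewrite -(Gauss_dvdpr _ cHG) E dvdp_mull.
have H0 : H != 0 by rewrite -size_poly_gt0 ltnW.
have H'0 : H^`() != 0.
  apply/eqP => /polyP/(_ (size H).-2); rewrite coef0 coef_deriv.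
  case: (size H) (lead_coefE H) size_H => [|[|n]] //= lE _ /eqP.
  by rewrite mulrn_eq0 /= -lE lead_coef_eq0 (negPf H0).
by move/(dvdp_leq H'0); rewrite leqNgt lt_size_deriv.
Qed.

(** A multiple root of any member of the pencil is a root of the Wronskian of [G] and [H], which is
    the same for all members. So [pencil_avoid] need only be applied to finitely many points. *)
Lemma pencil_separable (C : numClosedFieldType) (G H : {poly rat}) :
  coprimep G H -> (1 < size H)%N ->
  exists N, forall n, (N < n)%N -> separable_poly (G + n%:R^-1 *: H).
Proof.
move=> cGH size_H; pose f := map_poly (ratr : rat -> C).
have cGHC : coprimep (f G) (f H) by rewrite coprimep_map.
have size_HC : (1 < size (f H))%N by rewrite size_map_poly.
have [Z ZE] := closed_field_poly_normal (f G * (f H)^`() - (f G)^`() * f H).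
have [N NP] := @pencil_avoid C _ _ Z cGHC.
exists N => n ltNn; rewrite separable_poly.unlock -(@coprimep_map _ C ratr).
rewrite -deriv_map -/f.
have -> : f (G + n%:R^-1 *: H) = f G + n%:R^-1 *: f H.
  by rewrite /f rmorphD /= map_polyZ /= fmorphV /= ratr_nat.
apply/Pdiv.ClosedField.coprimepP => z rz; apply/eqP => dz.
have W0 : (f G * (f H)^`() - (f G)^`() * f H).[z] = 0.
  move: dz rz; rewrite derivD derivZ /root !hornerE => dz /eqP rz.
  move: (f G).[z] (f H).[z] (f G)^`().[z] (f H)^`().[z] n%:R^-1 dz rz.
  move=> g h g' h' l dz rz.
  have -> : g * h' - g' * h = (g + l * h) * h' - (g' + l * h') * h by ring.
  by rewrite dz rz !mul0r subrr.
have zZ : z \in Z.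
  have : root (f G * (f H)^`() - (f G)^`() * f H) z by apply/eqP.
  by rewrite ZE rootZ ?root_prod_XsubC // lead_coef_eq0 wronskian_neq0.
by move: rz; apply/negP; rewrite /root NP.
Qed.

Lemma interpolation (F : fieldType) (s : seq F) (w : F -> F) : uniq s ->
  exists2 G : {poly F}, (size G <= size s)%N & {in s, forall a, G.[a] = w a}.
Proof.
elim: s => [|a s IH] /=; first by exists 0; rewrite ?size_poly0.
case/andP=> as_ /IH[G size_G GE]; pose P := \prod_(b <- s) ('X - b%:P).
have Pa : P.[a] != 0 by rewrite -/(root _ _) root_prod_XsubC.
exists (G + ((w a - G.[a]) / P.[a]) *: P).
  rewrite (leq_trans (size_polyD _ _)) // geq_max (leqW size_G) /=.
  by rewrite (leq_trans (size_scale_leq _ _)) // size_prod_XsubC.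
move=> b; rewrite in_cons !hornerE => /predU1P[->|bs].
  by rewrite divfK // addrC subrK.
have /eqP-> : root P b by rewrite root_prod_XsubC.
by rewrite mulr0 addr0 GE.
Qed.

(** * Points of the projective superelliptic curve *)

Lemma mcoeff_superelliptic_affine (K : fieldType) (d : nat) (f : {poly K}) (m : 'X_{1..2}) :
  (superelliptic_affine d f)@_m =
    ((U_(1%R) *+ d)%MM == m)%:R - \sum_(i < size f) f`_i * ((U_(0%R) *+ i)%MM == m)%:R.
Proof.
rewrite /superelliptic_affine mcoeffB mpolyXn mcoeffX; congr (_ - _).
rewrite (@horner_coef_wide _ (size f)) ?size_poly // raddf_sum /=.
by apply: eq_bigr => i _; rewrite coef_map mpolyXn mcoeffCM mcoeffX.
Qed.

Lemma mcoeff_superelliptic_affineX (K : fieldType) (d : nat) (f : {poly K}) (i : nat) :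
  (0 < d)%N -> (superelliptic_affine d f)@_(U_(0%R) *+ i)%MM = - f`_i.
Proof.
move=> d_gt0; rewrite mcoeff_superelliptic_affine.
have -> : (U_(1%R) *+ d == U_(0%R) *+ i :> 'X_{1..2})%MM = false.
  apply/negP => /eqP/mnmP/(_ 1%R); rewrite !mulmnE !mnm1E /= mul0n mul1n => d0.
  by rewrite d0 in d_gt0.
rewrite sub0r; congr (- _).
have eqX j : (U_(0%R) *+ j == U_(0%R) *+ i :> 'X_{1..2})%MM = (j == i).
  apply/eqP/eqP => [/mnmP/(_ 0%R)|->//].
  by rewrite !mulmnE !mnm1E eqxx !mul1n.
have [lt_if|le_fi] := ltnP i (size f).
  rewrite (bigD1 (Ordinal lt_if)) //= eqX eqxx mulr1 big1 ?addr0 // => j ne_ji.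
  by rewrite eqX (_ : (j == i :> nat) = false) ?mulr0 //; apply: negbTE.
rewrite nth_default // big1 // => j _; rewrite eqX.
by rewrite (_ : (j == i :> nat) = false) ?mulr0 //; have := ltn_ord j; lia.
Qed.

Lemma mcoeff_superelliptic_affineY (K : fieldType) (d : nat) (f : {poly K}) :
  (0 < d)%N -> (superelliptic_affine d f)@_(U_(1%R) *+ d)%MM = 1.
Proof.
move=> d_gt0; rewrite mcoeff_superelliptic_affine eqxx big1 ?subr0 // => i _.
case: eqP => [/mnmP/(_ 1%R)|_]; last by rewrite mulr0.
by rewrite !mulmnE !mnm1E /= mul0n mul1n => d0; rewrite -d0 in d_gt0.
Qed.

Lemma meval_superelliptic_curve (K : fieldType) (d : nat) (f : {poly K}) (v : 'I_3 -> K) :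
  (0 < d)%N -> size f = d.+1 ->
  (superelliptic_curve d f).@[v] =
    v 1%R ^+ d - \sum_(i < d.+1) f`_i * v 0%R ^+ i * v ord_max ^+ (d - i).
Proof.
move=> d_gt0 size_f; set p := superelliptic_affine d f.
pose X (i : nat) : 'X_{1..2} := (U_(0%R) *+ i)%MM.
(* A duplicate-free list containing the support; monomials where [f] has a zero coefficient only add
   zero terms. *)
pose s := (U_(1%R) *+ d)%MM :: map X (iota 0 d.+1).
have X_inj : injective X.
  move=> i j /mnmP/(_ 0%R).
  by rewrite !mulmnE !mnm1E eqxx !mul1n.
have s_uniq : uniq s.
  rewrite cons_uniq map_inj_uniq // iota_uniq andbT.
  apply/negP => /mapP[j _ /mnmP/(_ 1%R)].
  by rewrite !mulmnE !mnm1E /= mul0n mul1n => d0; rewrite d0 in d_gt0.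
have sub_ps : {subset msupp p <= s}.
  move=> m; apply: contraLR; rewrite -mcoeff_eq0 in_cons negb_or => /andP[mY mX].
  rewrite mcoeff_superelliptic_affine [(U_(1%R) *+ d)%MM == m]eq_sym (negPf mY) big1 ?subr0 // => i _.
  case: eqP => [E|_]; last by rewrite mulr0.
  case/negP: mX; apply/mapP; exists (i : nat) => //.
  by rewrite mem_iota -size_f ltn_ord.
(* The monomial in [y] alone has coefficient 1, so the total degree, and with it the homogenizing
   exponent, is exactly [d]. *)
have size_p : msize p = d.+1.
  apply/eqP; rewrite eqn_leq; apply/andP; split.
    rewrite msizeE; apply/bigmax_leqP_seq => m /sub_ps + _; rewrite in_cons => /orP[/eqP->|/mapP[j]].
      by rewrite mdegMn mdeg1 mul1n.
    by rewrite mem_iota => /andP[_ lt_id] ->; rewrite mdegMn mdeg1 mul1n.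
  have /msize_mdeg_lt : (U_(1%R) *+ d)%MM \in msupp p.
    by rewrite mcoeff_msupp mcoeff_superelliptic_affineY ?oner_eq0.
  by rewrite mdegMn mdeg1 mul1n.
have homogE m : ('X_[homog_mnm d m]).@[v] = v 0%R ^+ m 0%R * v 1%R ^+ m 1%R * v ord_max ^+ (d - mdeg m).
  rewrite mevalX big_ord_recr /= mnmE unlift_none; congr (_ * _).
  have widenE (i : 'I_2) : widen_ord (leqnSn 2) i = lift ord_max i.
    by apply: val_inj; rewrite /= /bump leqNgt ltn_ord.
  rewrite big_ord_recl big_ord1 !widenE !mnmE !liftK.
  by congr (v _ ^+ _ * v _ ^+ m _); apply: val_inj.
rewrite /superelliptic_curve /homogenize -/p size_p /= raddf_sum /=.
under eq_bigr => m _ do rewrite mevalZ homogE.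
pose F (m : 'X_{1..2}) := p@_m * (v 0%R ^+ m 0%R * v 1%R ^+ m 1%R * v ord_max ^+ (d - mdeg m)).
rewrite -[X in X = _]/(\sum_(m <- msupp p) F m).
have -> : \sum_(m <- msupp p) F m = \sum_(m <- s) F m.
  rewrite [RHS](bigID (mem (msupp p))) /= [X in _ + X]big1 ?addr0; last first.
    by move=> m /memN_msupp_eq0 p0; rewrite /F p0 mul0r.
  rewrite -[RHS]big_filter; apply: perm_big.
  apply: uniq_perm; rewrite ?filter_uniq ?msupp_uniq // => m.
  by rewrite mem_filter; case: (boolP (m \in _)) => // /sub_ps ->.
rewrite big_cons big_map -[X in iota 0 X]subn0 -/(index_iota 0 d.+1) big_mkord.
rewrite /F mcoeff_superelliptic_affineY // !mulmnE !mnm1E mdegMn mdeg1 /= !mul1n mul0n.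
rewrite subnn !expr0 !(mul1r, mulr1) -sumrN; congr (_ + _); apply: eq_bigr => i _.
rewrite mcoeff_superelliptic_affineX // !mulmnE !mnm1E mdegMn mdeg1 /= !mul1n mul0n.
by rewrite expr0 mulr1 !mulNr mulrA.
Qed.

Lemma homogeneous_sum_affine (K : fieldType) (d : nat) (f : {poly K}) (x z : K) :
  size f = d.+1 -> z != 0 ->
  \sum_(i < d.+1) f`_i * x ^+ i * z ^+ (d - i) = z ^+ d * f.[x / z].
Proof.
move=> size_f z0; rewrite horner_coef size_f mulr_sumr; apply: eq_bigr => i _.
rewrite expr_div_n -[X in z ^+ X * _](@subnK i d) -1?ltnS // exprD.
by field; rewrite expf_neq0.
Qed.

Lemma homogeneous_sum_infinity (K : fieldType) (d : nat) (f : {poly K}) (x : K) :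
  size f = d.+1 ->
  \sum_(i < d.+1) f`_i * x ^+ i * 0 ^+ (d - i) = lead_coef f * x ^+ d.
Proof.
move=> size_f; rewrite big_ord_recr /= subnn expr0 mulr1 big1 ?add0r => [|i _].
  by rewrite lead_coefE size_f.
by rewrite expr0n subn_eq0 leqNgt ltn_ord mulr0.
Qed.

Lemma proj_points_superelliptic (K : fieldType) (d : nat) (f : {poly K}) (S : set (K * K)) :
  (0 < d)%N -> size f = d.+1 ->
  (forall w : K, w ^+ d <> lead_coef f) ->
  (forall s : K * K, s.2 ^+ d = f.[s.1] <-> S s) ->
  proj_points (superelliptic_curve d f) = @std_chart K @` S.
Proof.
move=> d_gt0 size_f no_inf affS; apply/seteqP; split=> [L LP|_ [s Ss <-]]; last first.
  move=> v /vlineP[k ->]; rewrite meval_superelliptic_curve // !mxE !(tnth_nth 0) /=.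
  (* The zero vector belongs to every line; the form vanishes there because [d] is positive. *)
  rewrite mulr1; have [->|k0] := eqVneq k 0.
    by rewrite !mul0r homogeneous_sum_infinity // expr0n eqn0Ngt d_gt0 mulr0 subr0.
  by rewrite homogeneous_sum_affine // mulrAC divff // mul1r exprMn ((affS s).2 Ss) subrr.
have dimL := valP L.
have /LP := memv_pick (val L); set w := vpick _.
have w0 : w != 0 by rewrite vpick0 -dimv_eq0 (eqP dimL).
have LE : val L = <[w]>%VS.
  apply/esym/eqP; rewrite eqEdim -memvE memv_pick (eqP dimL) dim_vline w0 //.
rewrite meval_superelliptic_curve //; set x := w 0 0; set y := w 0 1; set z := w 0 ord_max.
have wE : w = \row_(i < 3) tnth [tuple x; y; z] i.
  apply/rowP => i; rewrite mxE (tnth_nth 0).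
  by case: i => [[|[|[|//]]] lt_i] /=; congr (w _ _); apply: val_inj.
(* At infinity the equation reads [y ^+ d = lead_coef f * x ^+ d], so [y / x] would be a forbidden
   root of the leading coefficient; [x = 0] would make [w] zero. *)
have [z0|z0] := eqVneq z 0.
  rewrite z0 homogeneous_sum_infinity // => /eqP; rewrite subr_eq0 => /eqP E.
  have [x0|x0] := eqVneq x 0.
    have y0 : y = 0.
      by move/eqP: E; rewrite x0 expr0n eqn0Ngt d_gt0 mulr0 expf_eq0 d_gt0 => /eqP.
    case/eqP: w0; rewrite wE x0 y0 z0; apply/rowP => i; rewrite !mxE (tnth_nth 0).
    by case: i => [[|[|[|//]]] lt_i].
  case: (no_inf (y / x)).
  by rewrite expr_div_n E mulfK // expf_neq0.
rewrite homogeneous_sum_affine // => /eqP; rewrite subr_eq0 => /eqP E.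
exists (x / z, y / z).
  by apply/affS; rewrite /= expr_div_n E mulrC mulKf // expf_neq0.
apply: val_inj; rewrite /= LE.
have -> : \row_(i < 3) tnth [tuple x / z; y / z; 1] i = z^-1 *: w.
  apply/rowP => i; rewrite wE !mxE !(tnth_nth 0).
  by case: i => [[|[|[|//]]] lt_i] /=; rewrite ?(mulrC z^-1) // mulfV.
apply/eqP; rewrite eqEdim -memvE rpredZ ?memv_line //= !dim_vline scaler_eq0 invr_eq0.
by rewrite (negPf z0) w0.
Qed.

(** * Construction of the curve *)

(** Dividing by [t ^+ 3 * B ^+ 6] gives a rational point of [Y ^+ 2 + 1 = X ^+ 3]. *)
Lemma cube_eq_twisted_sum (t A B u : rat) :
  u ^+ 3 = t * A ^+ 2 + t ^+ 3 * B ^+ 6 -> t != 0 -> B != 0 -> A = 0.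
Proof.
move=> uE t0 B0; have : A / (t * B ^+ 3) = 0.
  apply: (@sqr_add1_eq_cube (u / (t * B ^+ 2))).
  rewrite [RHS]expr_div_n uE; field; exact/andP.
by move/eqP; rewrite mulf_eq0 invr_eq0 mulf_eq0 expf_eq0 (negPf t0) (negPf B0) orbF => /eqP.
Qed.

Lemma coprimep_prod_XsubC (F : fieldType) (G : {poly F}) (T : eqType) (s : seq T) (c : T -> F) :
  (forall a, a \in s -> G.[c a] != 0) -> coprimep G (\prod_(a <- s) ('X - (c a)%:P)).
Proof.
move=> G0; rewrite big_seq; elim/big_ind: _ => [|p q cp cq|a as_].
- exact: coprimep1.
- by rewrite coprimepMr cp.
by rewrite coprimep_XsubC /root G0.
Qed.

Lemma root_prod_XsubC_map (F : fieldType) (T : Type) (s : seq T) (c : T -> F) (x : F) :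
  root (\prod_(a <- s) ('X - (c a)%:P)) x = (x \in map c s).
Proof. by rewrite -root_prod_XsubC big_map. Qed.

Lemma size_lead_coefD (F : fieldType) (p q : {poly F}) :
  size p = size q -> lead_coef p + lead_coef q != 0 ->
  size (p + q) = size p /\ lead_coef (p + q) = lead_coef p + lead_coef q.
Proof.
move=> spq lpq.
have cE : (p + q)`_(size p).-1 = lead_coef p + lead_coef q.
  by rewrite coefD !lead_coefE spq.
have sE : size (p + q) = size p.
  apply/eqP; rewrite eqn_leq; apply/andP; split.
    by rewrite (leq_trans (size_polyD _ _)) // -spq maxnn.
  have /leq_trans-> // : (size p <= (size p).-1.+1)%N by case: size.
  by rewrite ltnNge; apply: contra lpq => le_s; rewrite -cE nth_default.
by rewrite lead_coefE sE cE.
Qed.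

(** Supplies both [t] and [A]. Adding [H / p] to an interpolant keeps its values on [s], where [H]
    vanishes, and sets the degree, which [s'] adjusts. The prime [p] exceeds the bounds for rational
    roots, for separability and for avoiding [Z]. *)
Lemma exists_polynomial_through (C : numClosedFieldType) (s s' : seq int)
    (w : rat -> rat) (Z : seq C) :
  uniq s -> (0 < size s)%N -> {subset s' <= s} -> (forall a, w a != 0) ->
  exists F : {poly rat},
    [/\ size F = (size s * 2 + size s').+1,
        forall a, a \in s -> F.[a%:~R] = w a%:~R,
        forall x, F.[x] != 0,
        separable_poly F
      & forall z, z \in Z -> (map_poly ratr F).[z] != 0].
Proof.
move=> s_uniq s_gt0 sub_s w0; pose c (a : int) : rat := a%:~R.
have [|G size_G GE] := @interpolation _ (map c s) w.
  by rewrite map_inj_uniq //; apply: intr_inj.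
rewrite size_map in size_G.
have {}GE a : a \in s -> G.[c a] = w (c a) by move=> as_; rewrite GE // map_f.
have G0 a : a \in s -> G.[c a] != 0 by move=> as_; rewrite GE.
pose P := \prod_(a <- s) ('X - (c a)%:P); pose P' := \prod_(a <- s') ('X - (c a)%:P).
have mP : P \is monic by apply: monic_prod_XsubC.
have mP' : P' \is monic by apply: monic_prod_XsubC.
have sH : size (P ^+ 2 * P') = (size s * 2 + size s').+1.
  rewrite size_monicM ?monic_neq0 ?monic_exp //.
  rewrite expr2 size_monicM ?monic_neq0 // !size_prod_XsubC; lia.
have cGH : coprimep G (P ^+ 2 * P').
  rewrite coprimepMr coprimep_expr ?coprimep_prod_XsubC // => a /sub_s.
  exact: G0.
have [|N1 N1P] := no_rational_root G s s' sub_s _ G0.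
  by apply: (leq_trans size_G); lia.
have [|N2 N2P] := pencil_separable C _ _ cGH; first by (rewrite sH; lia).
have [|N3 N3P] := @pencil_avoid C (map_poly ratr G) (map_poly ratr (P ^+ 2 * P')) Z.
  by rewrite coprimep_map.
have [p lt_p p_pr] := prime_above (maxn N1 (maxn N2 N3)).
move: lt_p; rewrite !gtn_max => /and3P[lt1 lt2 lt3].
have p0 : p%:R^-1 != 0 :> rat by rewrite invr_eq0 pnatr_eq0 -lt0n prime_gt0.
exists (G + p%:R^-1 *: (P ^+ 2 * P')); split.
- rewrite addrC size_polyDl size_scale // sH //.
  by apply: (leq_ltn_trans size_G); lia.
- move=> a as_; rewrite hornerD hornerZ hornerM horner_exp GE //.
  have /eqP-> : root P (c a) by rewrite root_prod_XsubC_map map_f.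
  by rewrite expr0n mul0r mulr0 addr0.
- exact: N1P.
- exact: N2P.
move=> z /(N3P _ lt3).
by rewrite rmorphD /= map_polyZ /= fmorphV /= ratr_nat.
Qed.

Lemma size_expS (R : idomainType) (p : {poly R}) (k n : nat) :
  size p = k.+1 -> size (p ^+ n) = (k * n).+1.
Proof.
move=> size_p; rewrite -[k]/(k.+1.-1) -size_p -size_exp prednK // size_poly_gt0.
by rewrite expf_neq0 // -size_poly_gt0 size_p.
Qed.

Lemma odd_exp_inj (d : nat) (x y : rat) : odd d -> y != 0 -> x ^+ d = y ^+ d -> x = y.
Proof.
move=> d_odd y0 xyE; have E : (x / y) ^+ d = 1.
  by rewrite expr_div_n xyE divff // expf_neq0.
have xy0 : 0 < x / y by rewrite -(exprn_odd_gt0 _ d_odd) E.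
have /eqP : x / y == 1 by rewrite -(@pexpr_eq1 _ _ d) ?ltW ?E // odd_gt0.
by move/(canRL (divfK y0)); rewrite mul1r.
Qed.

Lemma exists_superelliptic_polynomial (C : numClosedFieldType) (s : seq int)
    (w : rat -> rat) (Z : seq C) :
  uniq s -> 0 \notin s -> (forall a, w a != 0) ->
  exists (d : nat) (f : {poly rat}),
    [/\ (4 <= d)%N,
        size f = d.+1,
        separable_poly f,
        forall z, z \in Z -> (map_poly ratr f).[z] != 0
      & (forall u, u ^+ d <> lead_coef f) /\
        (forall x y, y ^+ d = f.[x] <-> exists2 a : int, a \in s & x = a%:~R /\ y = w x)].
Proof.
move=> s_uniq s0 w0; pose r := size s.
(* The extra node 0 makes [deg t = 2 r + 3] odd, hence so is [d = 12 r + 9]. *)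
pose s0s := 0 :: s.
have s0s_uniq : uniq s0s by rewrite /= s0.
have [|t [size_t tE t0 sep_t tZ]] :=
    @exists_polynomial_through C s0s [:: 0] w Z s0s_uniq isT _ w0.
  by move=> a; rewrite !in_cons orbF => ->.
have [Zt ZtE] := closed_field_poly_normal (map_poly (ratr : rat -> C) t).
have {}size_t : size t = (2 * r + 3).+1 by rewrite size_t /= -/r; congr S; ring.
(* The exponent makes [t * A ^+ 2] equal to [w a ^+ (1 + 2 * (6 * r + 4))] at a node, that is
   [w a ^+ d]. The repeated roots give degree [5 * r + 3], and avoiding the roots [Zt] makes [A]
   coprime to [t]. *)
have [||A [size_A AE A0 _ AZ]] :=
    @exists_polynomial_through C s0s (0 :: s ++ s ++ s)
      (fun a => w a ^+ (6 * r + 4)) Zt s0s_uniq isT.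
- by move=> a; rewrite !in_cons !mem_cat !orbb.
- by move=> a; rewrite expf_neq0.
have {}size_A : size A = (5 * r + 3).+1 by rewrite size_A /= !size_cat -/r; congr S; ring.
have t_neq0 : t != 0 by rewrite -size_poly_eq0 size_t.
have A_neq0 : A != 0 by rewrite -size_poly_eq0 size_A.
have lt0 : lead_coef t != 0 by rewrite lead_coef_eq0.
have lA0 : lead_coef A != 0 by rewrite lead_coef_eq0.
pose P : {poly rat} := \prod_(a <- s) ('X - (a%:~R)%:P).
have mP : P \is monic by apply: monic_prod_XsubC.
have size_P : size P = r.+1 by rewrite size_prod_XsubC.
have ctA : coprimep t A.
  rewrite -(@coprimep_map _ C ratr); apply/Pdiv.ClosedField.coprimepP => z tz.
  apply: AZ; move: tz; rewrite ZtE rootZ ?root_prod_XsubC //.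
  by rewrite lead_coef_map fmorph_eq0.
have cAP : coprimep A P by apply: coprimep_prod_XsubC => a _; apply: A0.
pose G := A ^+ 2; pose H := t ^+ 2 * P ^+ 6.
have cGH : coprimep G H.
  by rewrite coprimep_expl // coprimepMr !coprimep_expr // coprimep_sym.
have size_G : size G = (10 * r + 6).+1.
  by rewrite (size_expS _ _ _ _ size_A); congr S; ring.
have size_H : size H = (10 * r + 6).+1.
  rewrite /H size_Mmonic ?monic_exp ?expf_neq0 //.
  by rewrite (size_expS _ _ _ _ size_t) (size_expS _ _ _ _ size_P) addnS /=; ring.
have lH : lead_coef H = lead_coef t ^+ 2.
  by rewrite /H lead_coef_Mmonic ?monic_exp // lead_coef_exp.
have [|N1 N1P] := pencil_separable C _ _ cGH; first by rewrite size_H addnC.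
have [|N2 N2P] := @pencil_avoid C (map_poly ratr G) (map_poly ratr H) Z.
  by rewrite coprimep_map.
(* The pencil parameter is a sixth power so that it can be absorbed into [B = P / n]. *)
have [n [n_gt0 lt1 lt2]] : exists n, [/\ (0 < n)%N, (N1 < n ^ 6)%N & (N2 < n ^ 6)%N].
  exists (maxn N1 N2).+1; have le_n n : (n.+1 <= n.+1 ^ 6)%N.
    by rewrite -{1}(expn1 n.+1) leq_pexp2l.
  by split=> //; rewrite (leq_trans _ (le_n _)) // ltnS ?leq_maxl ?leq_maxr.
have n0 : n%:R != 0 :> rat by rewrite pnatr_eq0 -lt0n.
pose F := G + (n ^ 6)%:R^-1 *: H.
have sep_F : separable_poly F by apply: N1P.
have n6 : (n ^ 6)%:R^-1 != 0 :> rat by rewrite invr_eq0 natrX expf_neq0.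
(* The leading coefficients cannot cancel: one is a positive square, the other is nonnegative. *)
have [size_F lF] : size F = (10 * r + 6).+1 /\
    lead_coef F = lead_coef A ^+ 2 + (n ^ 6)%:R^-1 * lead_coef t ^+ 2.
  rewrite -lH -lead_coef_exp -lead_coefZ -size_G.
  apply: size_lead_coefD; first by rewrite size_scale // size_G.
  rewrite lead_coefZ lH lead_coef_exp gt_eqF // ltr_pwDl //.
    by rewrite exprn_even_gt0.
  by rewrite mulr_ge0 ?invr_ge0 ?ler0n ?sqr_ge0.
(* Stated for scalars because it serves twice: for values at a point, and for leading coefficients,
   where the monic [P] contributes 1. *)
have fE (u t' A' P' : rat) : u = t' * (A' ^+ 2 + (n ^ 6)%:R^-1 * (t' ^+ 2 * P' ^+ 6)) ->
    u = t' * A' ^+ 2 + t' ^+ 3 * (P' / n%:R) ^+ 6.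
  by move=> ->; rewrite natrX; field.
have dE : (12 * r + 9 = (4 * r + 3) * 3)%N by ring.
exists (12 * r + 9)%N, (t * F); split.
- by rewrite addnC.
- have F0 : F != 0 by rewrite -size_poly_eq0 size_F.
  by rewrite (size_mul t_neq0 F0) size_t size_F addnS /=; ring.
- rewrite separable_mul sep_t sep_F /=.
  (* Modulo [t], [F] reduces to [A ^+ 2], which is coprime to [t]. *)
  rewrite /F addrC /H expr2 -mulrA scalerAr mulrC coprimep_addl_mul.
  by rewrite coprimep_expr.
- move=> z zZ; rewrite rmorphM hornerM mulf_neq0 ?tZ //.
  by move: (N2P _ lt2 _ zZ); rewrite /F rmorphD /= map_polyZ /= fmorphV /= ratr_nat.
split=> [u uE|x y].
  move: uE; rewrite dE exprM lead_coefM lF -[lead_coef t ^+ 2 in X in _ + X]mulr1 -(expr1n _ 6).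
  by move/fE/cube_eq_twisted_sum => /(_ lt0 _)/eqP; rewrite (negPf lA0) mul1r invr_eq0 => /(_ n0).
have fxE : (t * F).[x] = t.[x] * A.[x] ^+ 2 + t.[x] ^+ 3 * (P.[x] / n%:R) ^+ 6.
  by apply: fE; rewrite /F /G /H !hornerE.
have Pa a : a \in s -> P.[a%:~R] = 0.
  by move=> as_; apply/eqP; rewrite -/(root _ _) root_prod_XsubC_map map_f.
have fxE' a : a \in s -> (t * F).[a%:~R] = w a%:~R ^+ (12 * r + 9).
  move=> as_; have as0 : a \in s0s by rewrite in_cons as_ orbT.
  rewrite hornerM /F hornerD hornerZ /G /H (hornerM (t ^+ 2)) !horner_exp Pa // expr0n !mulr0 addr0.
  rewrite tE // AE // -exprM -exprS; congr (_ ^+ _); ring.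
split=> [|[a as_ [-> ->]]].
  (* At a root of [P] the ordinate is determined because [d] is odd; elsewhere [cube_eq_twisted_sum]
     would make [x] a rational root of [A]. *)
  have [Px|Px] := eqVneq P.[x] 0.
    have [a as_ xE] : exists2 a, a \in s & x = a%:~R.
      have : root P x by apply/eqP.
      by rewrite root_prod_XsubC_map => /mapP.
    rewrite xE fxE' // => yE; exists a => //; split=> //.
    by apply: odd_exp_inj yE => //; rewrite oddD oddM.
  rewrite fxE dE exprM => /cube_eq_twisted_sum => /(_ (t0 x) _)/eqP.
  by rewrite (negPf (A0 x)) mulf_neq0 ?invr_eq0 // => /(_ isT).
by rewrite fxE'.
Qed.

Lemma acceptable_graph (S : {fset rat * rat}) : acceptable S ->
  exists (s : seq int) (w : rat -> rat),
    [/\ uniq s, 0 \notin s, forall a, w a != 0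
      & forall p : rat * rat,
          (exists2 a : int, a \in s & p.1 = a%:~R /\ p.2 = w p.1) <-> p \in S].
Proof.
case=> S_inj S_neq0 S_int; pose s := [seq numq p.1 | p <- S].
(* The default pair [(0, 1)] gives [w] the value 1 off the abscissas of [S], so that it vanishes
   nowhere, in particular not at the extra node 0. *)
pose w (a : rat) := (head (0, 1) [seq p <- S | p.1 == a]).2.
have numK p : p \in S -> (numq p.1)%:~R = p.1.
  by case/S_int => /numqK.
have wS p : p \in S -> w p.1 = p.2.
  move=> pS; rewrite /w.
  have : p \in [seq q <- S | q.1 == p.1] by rewrite mem_filter eqxx.
  case E : [seq q <- S | q.1 == p.1] => [//|q l] _ /=.
  have : q \in [seq q <- S | q.1 == p.1] by rewrite E mem_head.
  by rewrite mem_filter => /andP[/eqP qp qS]; apply: S_inj.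
exists s, w; split.
- rewrite map_inj_in_uniq ?fset_uniq // => p q pS qS /= /(congr1 (intr : int -> rat)).
  rewrite /= !numK // => pq; have := S_inj _ _ pS qS pq.
  by case: p q pq {pS qS} => [? ?] [? ?] /= -> ->.
- apply/negP => /mapP[p pS p0]; have [] := S_neq0 _ pS.
  by rewrite -numK // -p0 eqxx.
- move=> a; rewrite /w; case E : [seq p <- S | p.1 == a] => [|q l] //=.
  have : q \in [seq p <- S | p.1 == a] by rewrite E mem_head.
  by rewrite mem_filter => /andP[_ /S_neq0[]].
move=> p; split=> [[_ /mapP[q qS ->] [pq pw]]|pS].
  rewrite /= numK // in pq; rewrite (_ : p = q) //.
  by move: pw; rewrite pq wS //; case: p q pq {qS} => [? ?] [? ?] /= -> ->.
by exists (numq p.1); [apply/mapP; exists p | rewrite numK // wS].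
Qed.

Theorem theorem2p2 (R : realType) (S : {fset rat * rat}) (B : {fset R[i]}) :
  acceptable S ->
  exists (d : nat) (f : {poly rat}),
    [/\ (4 <= d)%N,
        size f = d.+1,
        separable_poly f,
        {in B, forall beta : R[i], (map_poly ratr f).[beta] != 0}
      & proj_points (superelliptic_curve d f) = @std_chart rat @` [set` S] ].
Proof.
move=> /acceptable_graph[s [w [s_uniq s0 w0 SE]]].
have [d [f [d_ge4 size_f sep_f fB [no_inf affE]]]] :=
  exists_superelliptic_polynomial R[i] s w B s_uniq s0 w0.
exists d, f; split=> //.
apply: proj_points_superelliptic => //; first exact: leq_trans d_ge4.
by move=> p; rewrite affE SE.
Qed.
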